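(* There exists a collection of languages that is generatable in the limit with noise level $i$ for every $i\in\mathbb N$, but is not noisily generatable in the limit.
   Context: A language is an infinite subset of a countably infinite universe $U$; a collection is a set of languages. A generator algorithm is an arbitrary function $G$ from finite sequences of elements of $U$ to $U$, with output $z_t=G(x_0,\dots,x_t)$, and $S_t=\{x_0,\dots,x_t\}$. A noisy enumeration of $K$ is an infinite sequence $x_0,x_1,\dots$ of pairwise distinct elements of $U$ with $K\subseteq\bigcup_j\{x_j\}$ and $|\bigcup_j\{x_j\}\setminus K|<\infty$; it has noise level $i$ if moreover $|\bigcup_j\{x_j\}\setminus K|\le i$. $G$ generates in the limit with noise level $i$ for $\mathcal C$ if for every $K\in\mathcal C$ and every noisy enumeration of $K$ with noise level at most $i$ there is $t^\star$ with $z_t\in K\setminus S_t$ for all $t\ge t^\star$ (the algorithm may depend on $i$). $G$ noisily generates in the limit for $\mathcal C$ if for every $K\in\mathcal C$ and every noisy enumeration of $K$ (of any finite noise level, unknown to $G$) there is $t^\star$ with $z_t\in K\setminus S_t$ for all $t\ge t^\star$. *)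

(* Defs.v *)
From mathcomp Require Import all_boot.
From mathcomp Require Import all_classical.
Set Implicit Arguments.
Unset Strict Implicit.
Unset Printing Implicit Defensive.
Local Open Scope classical_set_scope.
Local Open Scope card_scope.

Section GenerationInTheLimit.
Variable U : Type.
Implicit Types (K : set U) (C : set (set U)) (x : nat -> U).

Definition language K : Prop := infinite_set K.

Definition collection C : Prop := C `<=` language.

Definition generator : Type := seq U -> U.

Definition noisy_enumeration K x : Prop :=
  [/\ injective x, K `<=` range x & finite_set (range x `\` K)].

Definition noisy_enumeration_level (i : nat) K x : Prop :=
  noisy_enumeration K x /\ range x `\` K #<= `I_i.

Definition revealed x (t : nat) : set U := x @` `I_t.+1.

Definition output (G : generator) x (t : nat) : U := G (mkseq x t.+1).

Definition eventually_generates (G : generator) K x : Prop :=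
  exists tstar : nat, forall t : nat, (tstar <= t)%N ->
    (K `\` revealed x t) (output G x t).

Definition generates_with_noise_level (i : nat) (G : generator) C : Prop :=
  forall K, C K -> forall x, noisy_enumeration_level i K x ->
    eventually_generates G K x.

Definition noisily_generates (G : generator) C : Prop :=
  forall K, C K -> forall x, noisy_enumeration K x ->
    eventually_generates G K x.

Definition generatable_with_noise_level (i : nat) C : Prop :=
  exists G : generator, generates_with_noise_level i G C.

Definition noisily_generatable C : Prop :=
  exists G : generator, noisily_generates G C.

End GenerationInTheLimit.

(* Main.v *)
Require Import Defs.
From mathcomp Require Import all_boot.
From mathcomp Require Import all_classical.
Local Open Scope classical_set_scope.
Local Open Scope card_scope.

Set Implicit Arguments.
Unset Strict Implicit.

(** Fix injections [p], [q : nat -> U] with disjoint ranges. The collection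
consists of the sets that contain [p n] for all large [n] and no [q n]
([cofinite_languages]), and of the sets that contain every [q n]
([full_languages]).

If the noise level is at most [i], then seeing more than [i] elements of
[range q] proves that the language is full, and in a full language this
happens eventually. So it is enough to output a fresh [q n] once this has
happened, and a fresh [p n] with [n] large before.

Against a generator [G] unaware of the noise level, the adversary lists the
[p n] that [G] has not output before, and reveals a new [q n] exactly when the
output of [G] is a fresh element of [range p]. If this happens finitely often,
then [G] fails on the cofinite language of the [p n] that are listed, the [q n]
being finite noise. If it happens infinitely often, then all of [range q] is
listed, and the range of the enumeration is a full language which misses
infinitely many outputs of [G]. *)

(** * Fresh values of injective sequences *)

Lemma exists_fresh (U : eqType) (h : nat -> U) (A : seq U) :
  injective h -> exists n, h n \notin A.
Proof.
move=> h_inj; apply: contrapT => /forallNP hA.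
(* Pigeonhole: [A] cannot contain [(size A).+1] distinct values of [h]. *)
have := @uniq_leq_size _ (map h (iota 0 (size A).+1)) A.
rewrite (map_inj_uniq h_inj) iota_uniq size_map size_iota ltnn => /(_ isT).
move=> le_false; suff: false by []; apply: le_false => _ /mapP[n _ ->].
exact/negPn/negP/hA.
Qed.

Definition first_fresh (U : eqType) (h : nat -> U) (h_inj : injective h)
  (A : seq U) : nat := ex_minn (exists_fresh A h_inj).

Lemma first_freshP (U : eqType) (h : nat -> U) (h_inj : injective h)
  (A : seq U) : h (first_fresh h_inj A) \notin A.
Proof. by rewrite /first_fresh; case: ex_minnP. Qed.

Lemma first_fresh_min (U : eqType) (h : nat -> U) (h_inj : injective h)
  (A : seq U) (n : nat) : h n \notin A -> first_fresh h_inj A <= n.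
Proof. by rewrite /first_fresh; case: ex_minnP => m _; apply. Qed.

Lemma eventually_notin (U : eqType) (h : nat -> U) (A : seq U) :
  injective h -> exists T, forall t, T <= t -> h t \notin A.
Proof.
move=> h_inj; elim: A => [|a A [T hT]]; first by exists 0.
have [[n hn]|/forallNP na] := pselect (exists n, h n = a).
  exists (maxn T n.+1) => t; rewrite geq_max => /andP[Tt nt].
  rewrite in_cons negb_or hT // andbT -hn (inj_eq h_inj).
  by rewrite gtn_eqF.
exists T => t /hT tA; rewrite in_cons negb_or tA andbT.
by apply/eqP/na.
Qed.

Lemma tail_infinite (U : choiceType) (h : nat -> U) (K : set U) (k : nat) :
  injective h -> (forall n, k <= n -> K (h n)) -> infinite_set K.
Proof.
move=> h_inj hK /finite_seqP[s sK].
have [T hT] := @eventually_notin _ _ s h_inj.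
have := hK (maxn T k) (leq_maxr _ _).
by rewrite sK /=; apply/negP/hT/leq_maxl.
Qed.

Lemma mem_mkseq (U : eqType) (x : nat -> U) (t : nat) (u : U) :
  (u \in mkseq x t) <-> exists2 j, j < t & x j = u.
Proof.
split=> [/mapP[j]|[j jt <-]].
  by rewrite mem_iota => jt ->; exists j.
by apply/mapP; exists j; rewrite ?mem_iota.
Qed.

Lemma revealedP (U : eqType) (x : nat -> U) (t : nat) (u : U) :
  revealed x t u <-> u \in mkseq x t.+1.
Proof. by rewrite mem_mkseq; split=> -[j]; exists j. Qed.

Lemma take_mkseq (U : Type) (x : nat -> U) (j t : nat) :
  j <= t -> take j (mkseq x t) = mkseq x j.
Proof. by move=> jt; rewrite -map_take take_iota (minn_idPl jt). Qed.

(** * The collection and its generation at a known noise level *)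

Section Collection.
Variables (U : choiceType) (p q : nat -> U).
Hypotheses (p_inj : injective p) (q_inj : injective q).
Hypothesis pq : forall m n, p m <> q n.

Definition cofinite_languages : set (set U) :=
  [set K | (exists k, forall n, k <= n -> K (p n)) /\ forall n, ~ K (q n)].

Definition full_languages : set (set U) := [set K | forall n, K (q n)].

Definition hard_collection : set (set U) :=
  cofinite_languages `|` full_languages.

Lemma hard_collection_infinite : collection hard_collection.
Proof.
move=> K [[[k pK] _]|qK]; first exact: tail_infinite pK.
by apply: (@tail_infinite _ q _ 0) => // n _; apply: qK.
Qed.

Definition in_q (u : U) : bool := `[< range q u >].

Lemma shift_inj (k : nat) : injective (fun n => p (k + n)).
Proof. by move=> m n /p_inj /addnI. Qed.

(** The shift by [size s] pushes the index of the chosen [p n] past the unknown threshold of a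
    cofinite language. *)
Definition level_generator (i : nat) : generator U := fun s =>
  if i < count in_q s then q (first_fresh q_inj s)
  else p (size s + first_fresh (@shift_inj (size s)) s).

Lemma level_generator_fresh (i : nat) (s : seq U) :
  level_generator i s \notin s.
Proof.
rewrite /level_generator; case: ifP => _; first exact: first_freshP.
exact: (first_freshP (@shift_inj (size s))).
Qed.

(** By injectivity of [x], the counted positions carry distinct elements of [range x] outside
    [K]. *)
Lemma count_noise (i : nat) (K : set U) (x : nat -> U) (t : nat) :
  (forall n, ~ K (q n)) -> noisy_enumeration_level i K x ->
  count in_q (mkseq x t) <= i.
Proof.
move=> qK [[x_inj _ _] noise].
rewrite count_map -size_filter; set l := [seq _ <- _ | _].
have lu : uniq l by rewrite filter_uniq ?iota_uniq.
rewrite -card_le_II; apply: card_le_trans noise.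
have xl_inj : {in `I_(size l) &, injective (fun k => x (nth 0 l k))}.
  move=> a b; rewrite !inE /= => al bl /x_inj/eqP.
  by rewrite nth_uniq // => /eqP.
have /card_eqPle[_ le_l] := inj_card_eq xl_inj.
apply: card_le_trans le_l _; apply: subset_card_le => _ [k /= kl <-].
have := mem_nth 0 kl; rewrite mem_filter => /andP[/asboolP[n _ qn] _].
by split; [exists (nth 0 l k)|rewrite -qn; apply: qK].
Qed.

Lemma count_full (i : nat) (K : set U) (x : nat -> U) :
  (forall n, K (q n)) -> noisy_enumeration K x ->
  exists T, forall t, T <= t -> i < count in_q (mkseq x t).
Proof.
move=> qK [x_inj Kx _].
have /choice[j xj] : forall n, exists j, x j = q n.
  by move=> n; have [j _ xj] := Kx _ (qK n); exists j.
(* By this time [q 0], ..., [q i] have all been listed, at distinct positions. *)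
exists (\max_(k < i.+1) j k).+1 => t Tt.
rewrite count_map -size_filter -[i.+1](size_iota 0) -(size_map j).
apply: uniq_leq_size => [|_ /mapP[k + ->]].
  rewrite map_inj_uniq ?iota_uniq // => a b jab.
  by apply: q_inj; rewrite -!xj jab.
rewrite mem_iota add0n => /andP[_ ki].
rewrite mem_filter mem_iota /=; apply/andP; split.
  by apply/asboolP; exists k; rewrite ?xj.
apply: leq_trans Tt; rewrite ltnS.
exact: (@leq_bigmax _ (fun k : 'I_i.+1 => j k) (Ordinal ki)).
Qed.

Lemma level_generator_correct (i : nat) :
  generates_with_noise_level i (level_generator i) hard_collection.
Proof.
move=> K KC x xK.
suff [T hT] : exists T, forall t, T <= t -> K (output (level_generator i) x t).
  exists T => t /hT Kt; split=> // /revealedP.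
  exact/negP/level_generator_fresh.
rewrite /output /level_generator; case: KC => [[[k pK] qK]|qK].
  exists k => t kt; rewrite ifN -?leqNgt ?(count_noise _ qK xK) //; apply: pK.
  by rewrite size_mkseq; apply/(leq_trans kt)/(leq_trans (leqnSn t))/leq_addr.
have [T hT] := count_full i qK xK.1.
by exists T => t Tt; rewrite hT ?(leq_trans Tt) //; apply: qK.
Qed.

(** * The adversary against an arbitrary generator *)

Section Adversary.
Variable G : generator U.

(** The index [size s] is included, so that the current answer [G s] is avoided too. *)
Definition outputs_so_far (s : seq U) : seq U :=
  [seq G (take j s) | j <- iota 0 (size s).+1].

Definition hit (s : seq U) : bool :=
  `[< range p (G s) >] && (G s \notin s).

Definition next (s : seq U) : U :=
  if hit s then q (first_fresh q_inj s)
  else p (first_fresh p_inj (s ++ outputs_so_far s)).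

Definition history (t : nat) : seq U := iter t (fun s => rcons s (next s)) [::].

Definition adversary (t : nat) : U := next (history t).

Lemma historyE (t : nat) : history t = mkseq adversary t.
Proof.
by elim: t => // t IHt; rewrite mkseqS -IHt.
Qed.

Lemma adversaryE (t : nat) : adversary t = next (mkseq adversary t).
Proof. by rewrite -historyE. Qed.

Lemma next_fresh (s : seq U) : next s \notin s.
Proof.
rewrite /next; case: ifP => _; first exact: first_freshP.
have := first_freshP p_inj (s ++ outputs_so_far s).
by rewrite mem_cat negb_or => /andP[].
Qed.

Lemma adversary_inj : injective adversary.
Proof.
have neq j t : j < t -> adversary j <> adversary t.
  move=> jt e; have /negP := next_fresh (mkseq adversary t).
  by rewrite -adversaryE; apply; apply/mem_mkseq; exists j.
by move=> j t; case: (ltngtP j t) => // /neq // + /esym => /[apply].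
Qed.

Lemma adversary_range (t : nat) :
  range p (adversary t) \/ range q (adversary t).
Proof.
rewrite adversaryE /next; case: ifP => _; [right|left];
  by eexists.
Qed.

Lemma adversary_avoids_outputs (j t : nat) :
  j <= t -> range p (G (mkseq adversary j)) ->
  adversary t <> G (mkseq adversary j).
Proof.
move=> jt [n _ pn]; rewrite -pn adversaryE /next; case: ifP => [_ /esym /pq//|_].
rewrite pn => e.
have := first_freshP p_inj
  (mkseq adversary t ++ outputs_so_far (mkseq adversary t)).
rewrite e mem_cat negb_or => /andP[_ /mapP]; apply.
by exists j; rewrite ?take_mkseq // mem_iota size_mkseq.
Qed.

(** If [q n] were never listed, it would stay fresh, so each hit would list some [q m] with
    [m <= n]; injectivity allows this only finitely often. *)
Lemma infinite_hits_full :
  (forall T, exists2 t, T <= t & hit (mkseq adversary t)) ->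
  forall n, range adversary (q n).
Proof.
move=> hits n; apply: contrapT => qn.
have [T hT] := @eventually_notin _ _ (map q (iota 0 n.+1)) adversary_inj.
have [t /hT/negP + hit_t] := hits T; apply.
rewrite adversaryE /next hit_t map_f // mem_iota add0n ltnS /=.
apply: first_fresh_min; apply/negP => /mem_mkseq[j _ xj].
by apply: qn; exists j.
Qed.

(** An unlisted [p n] is not an answer from [T] on, as that would be a hit. If it is no earlier
    answer either, it stays available, and every later step lists some [p m] with [m <= n], against
    injectivity. *)
Lemma finite_hits_cofinite (T : nat) :
  (forall t, T <= t -> ~~ hit (mkseq adversary t)) ->
  exists k, forall n, k <= n -> range adversary (p n).
Proof.
move=> nohit.
pose early := [seq G (mkseq adversary j) | j <- iota 0 T].
have [k hk] := @eventually_notin _ _ early p_inj.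
exists k => n /hk pn_early; apply: contrapT => pn.
have pn_new t : p n \notin mkseq adversary t.
  by apply/negP => /mem_mkseq[j _ xj]; apply: pn; exists j.
have [T' hT'] := @eventually_notin _ _ (map p (iota 0 n.+1)) adversary_inj.
have /negP := hT' (maxn T T') (leq_maxr _ _); apply.
rewrite adversaryE /next (negbTE (nohit _ (leq_maxl _ _))).
rewrite map_f // mem_iota add0n ltnS /=; apply: first_fresh_min.
rewrite mem_cat negb_or pn_new /=; apply/negP => /mapP[j].
rewrite mem_iota size_mkseq add0n ltnS => /andP[_ jt].
rewrite take_mkseq // => pnE; have [jT|Tj] := ltnP j T.
  by move/negP: pn_early; apply; rewrite pnE map_f // mem_iota.
have /negP := nohit j Tj; apply; rewrite /hit -pnE pn_new andbT.
by apply/asboolP; exists n.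
Qed.

Lemma finite_hits_noise (T : nat) :
  (forall t, T <= t -> ~~ hit (mkseq adversary t)) ->
  finite_set (range adversary `&` range q).
Proof.
move=> nohit; apply: (@sub_finite_set _ _ (adversary @` `I_T)); last first.
  exact/finite_image/finite_II.
move=> _ [[t _ <-] [n _ qn]]; exists t => //=.
rewrite ltnNge; apply/negP => /nohit/negbTE tT.
by move: qn; rewrite adversaryE /next tT => /esym/pq.
Qed.

Lemma adversary_wins : ~ noisily_generates G hard_collection.
Proof.
move=> gen.
have [hits|/existsNP[T /forall2NP nohit]] :=
  pselect (forall T, exists2 t, T <= t & hit (mkseq adversary t)).
  have [||t0 ht0] := gen (range adversary) _ adversary.
  - by right; apply: infinite_hits_full.
  - split=> //; first exact: adversary_inj.
    by rewrite setDv; apply: finite_set0.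
  (* Output [t] answers the prefix of length [t.+1]; starting at [t0.+1] excludes the empty
     prefix. *)
  have [[//|t] t0t /andP[/asboolP Gp Gnew]] := hits t0.+1.
  have [[j _ xj] _] := ht0 t t0t.
  have [jt|tj] := ltnP j t.+1.
    by move/negP: Gnew; apply; apply/mem_mkseq; exists j.
  exact: adversary_avoids_outputs tj Gp xj.
have {}nohit t : T <= t -> ~~ hit (mkseq adversary t).
  by move=> Tt; apply/negP; case: (nohit t).
have [||t0 ht0] := gen (range adversary `\` range q) _ adversary.
- left; split=> [|n [_ []]]; last by exists n.
  have [k hk] := finite_hits_cofinite nohit.
  by exists k => n /hk pn; split=> // -[m _ /esym/pq].
- split; [exact: adversary_inj|by move=> u []|].
  by rewrite setDD; apply: finite_hits_noise nohit.
(* A correct output here is fresh and listed outside [range q], hence in [range p]: a hit after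
   [T]. *)
have [[[j _ xj] nq] new] := ht0 (maxn t0 T) (leq_maxl _ _).
have /negP := nohit _ (leq_trans (leq_maxr t0 T) (leqnSn _)); apply.
apply/andP; split; last by apply/negP => /revealedP.
by apply/asboolP; case: (adversary_range j); rewrite xj.
Qed.

End Adversary.

End Collection.

Theorem theorem1p5 (U : Type) (U_countably_infinite : [set: U] #= [set: nat]) :
  exists C : set (set U),
    [/\ collection C,
        forall i : nat, generatable_with_noise_level i C
      & ~ noisily_generatable C].
Proof.
have [g g_inj] : exists g : nat -> U, injective g.
  move: U_countably_infinite; rewrite card_eq_sym => /card_bijP[f [f' fK _]].
  exists (fun n => val (f (SigSub (mem_setT n)))) => m n /val_inj.
  by move/(can_inj fK) => [].
(* Even and odd indices give disjoint ranges; [{classic U}] supplies the [choiceType] structure. *)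
pose p n : {classic U} := g n.*2; pose q n : {classic U} := g n.*2.+1.
have p_inj : injective p by move=> m n /g_inj/double_inj.
have q_inj : injective q by move=> m n /g_inj[] /double_inj.
have pq m n : p m <> q n.
  by move=> /g_inj/(congr1 odd); rewrite /= !odd_double.
exists (hard_collection p q); split.
- exact: (hard_collection_infinite p_inj q_inj).
- move=> i; exists (level_generator p_inj q_inj i).
  exact: (level_generator_correct p_inj q_inj).
- by move=> [G]; apply: (adversary_wins p_inj q_inj pq).
Qed.
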